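(* For all integers $m\ge 0$ and $n\ge 1$, $$s_{((2m)^n)}(x_1,x_1^{-1},\dots,x_n,x_n^{-1})+s_{((2m)^{n-1})}(x_1,x_1^{-1},\dots,x_n,x_n^{-1})=\mathrm{sp}_{(m^n)}(x_1,\dots,x_n)\;o^{\mathrm{even}}_{(m^n)}(x_1,\dots,x_n),$$ as an identity of Laurent polynomials in the indeterminates $x_1,\dots,x_n$.
   Context: For integers $M,k\ge 0$, $(M^k)$ denotes the sequence $(M,M,\dots,M)$ with $k$ entries; a partition is padded with zeros to the number of variables when needed. Schur function: for a partition $\lambda=(\lambda_1\ge\dots\ge\lambda_N\ge 0)$, $$s_\lambda(x_1,\dots,x_N)=\frac{\det_{1\le h,t\le N}\left(x_h^{\lambda_t+N-t}\right)}{\det_{1\le h,t\le N}\left(x_h^{N-t}\right)}.$$ It is a polynomial in $x_1,\dots,x_N$. On the left-hand side of the claim both Schur functions are taken in $2n$ variables ($N=2n$), specialized to $x_1,x_1^{-1},\dots,x_n,x_n^{-1}$. Symplectic character: for a partition $\lambda=(\lambda_1,\dots,\lambda_N)$, $$\mathrm{sp}_\lambda(x_1,\dots,x_N)=\frac{\det_{1\le h,t\le N}\left(x_h^{\lambda_t+N-t+1}-x_h^{-(\lambda_t+N-t+1)}\right)}{\det_{1\le h,t\le N}\left(x_h^{N-t+1}-x_h^{-(N-t+1)}\right)}.$$ Even orthogonal character: for a non-increasing sequence $\lambda=(\lambda_1,\dots,\lambda_N)$ of non-negative integers, set $$o^{\mathrm{even}}_\lambda(x_1,\dots,x_N)=2\,\frac{\det_{1\le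 h,t\le N}\left(x_h^{\lambda_t+N-t}+x_h^{-(\lambda_t+N-t)}\right)}{\det_{1\le h,t\le N}\left(x_h^{N-t}+x_h^{-(N-t)}\right)}.$$ (This same formula, including the factor $2$, is used also when $\lambda_N=0$.) Both are Laurent polynomials in $x_1,\dots,x_N$. *)

(* Defs.v *)
From HB Require Import structures.
From mathcomp Require Import all_boot all_order all_algebra.
From mathcomp Require Import mpoly.
Set Implicit Arguments.
Unset Strict Implicit.
Unset Printing Implicit Defensive.
Import GRing.Theory.
Local Open Scope ring_scope.

(** Partitions are sequences of naturals, read through [nth 0%N] so that they
    are padded with zeros; [nseq k M] is the partition (M^k).  Indices are
    0-based: the columns t = 1, ..., N of the usual formulas are here
    t.+1 for t : 'I_N, so that N - t and N - t + 1 become N - t.+1 and N - t,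
    neither of which truncates.

    The characters are defined by their quotients of alternants, at a point x
    of F^N. In a field, division by zero gives zero: the formulas are meaningful
    only where the denominators do not vanish, as is the case below at the generic
    point [indet n] and, for [schur], at [with_inv (indet n)]. *)
Section Characters.
Variables (F : fieldType) (N : nat).
Implicit Types (lam : seq nat) (x : 'I_N -> F).

Definition schur lam x : F :=
  \det (\matrix_(h < N, t < N) x h ^+ (nth 0%N lam t + (N - t.+1)))
  / \det (\matrix_(h < N, t < N) x h ^+ (N - t.+1)).

Definition sp lam x : F :=
  \det (\matrix_(h < N, t < N)
          (x h ^+ (nth 0%N lam t + (N - t)) - x h ^- (nth 0%N lam t + (N - t))))
  / \det (\matrix_(h < N, t < N) (x h ^+ (N - t) - x h ^- (N - t))).

(** The factor 2 is present also when the last part of [lam] is 0. *)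
Definition o_even lam x : F :=
  2%:R *
  (\det (\matrix_(h < N, t < N)
           (x h ^+ (nth 0%N lam t + (N - t.+1))
            + x h ^- (nth 0%N lam t + (N - t.+1))))
   / \det (\matrix_(h < N, t < N) (x h ^+ (N - t.+1) + x h ^- (N - t.+1)))).

End Characters.

(** The point (x_1, x_1^-1, ..., x_n, x_n^-1). *)
Definition with_inv (F : fieldType) (n : nat) (x : 'I_n -> F) (h : 'I_n.*2) : F :=
  let i := Ordinal (etrans (ltn_half_double h n) (ltn_ord h)) in
  if odd h then (x i)^-1 else x i.

(** The indeterminates x_1, ..., x_n in Q(x_1, ..., x_n), which contains the
    Laurent polynomials as a subring. *)
Definition indet (n : nat) (i : 'I_n) : {fraction {mpoly rat[n]}} :=
  tofrac ('X_i : {mpoly rat[n]}).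

Arguments indet n i : clear implicits.

(* Main.v *)
(** Let y = (x_1, x_1^-1, ..., x_n, x_n^-1).  The numerators of the two Schur
    functions differ in the n-th column only, where the exponents are 2m+n and n.
    Add them in that column and divide each row by y_h^(m+n), which divides the
    determinant by 1: the columns become y^b for b = m+n-1, ..., m+1, then
    y^m + y^-m, then y^-b for b = m+1, ..., m+n.  With S_b = y^b + y^-b and
    A_b = y^b - y^-b, they are combinations of S_m, ..., S_(m+n-1),
    A_(m+1), ..., A_(m+n) and S_(m+n).  Only the rows x_i matter for these, as
    S_b and A_b are even and odd under inversion, so the determinant splits as
    K det(S) det(A); S_(m+n) only contributes an off-diagonal block.  The
    factor K does not depend on m, and the case m = 0, where both numerators are
    the Vandermonde denominator, eliminates it. *)

Require Import Defs.
From mathcomp Require Import all_boot all_order all_algebra.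
From mathcomp Require Import mpoly.
From mathcomp Require Import perm zify ring.
Import GRing.Theory.
Local Open Scope ring_scope.

(** * Alternants over a field *)

Section Alternants.
Variable F : fieldType.

Definition schur_num {N : nat} (lam : seq nat) (y : 'I_N -> F) : F :=
  \det (\matrix_(h < N, t < N) y h ^+ (nth 0%N lam t + (N - t.+1))).

Definition sym_mx {n N : nat} (m : nat) (x : 'I_N -> F) : 'M[F]_(N, n) :=
  \matrix_(h, t) (x h ^+ (m + (n - t.+1)) + x h ^- (m + (n - t.+1))).

Definition alt_mx {n N : nat} (m : nat) (x : 'I_N -> F) : 'M[F]_(N, n) :=
  \matrix_(h, t) (x h ^+ (m + (n - t)) - x h ^- (m + (n - t))).

(** The column S_(m+n) has no place among the n columns of [sym_mx]; it occurs
    only together with A_(m+n), column 0 of [alt_mx]. *)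
Definition sym_border {n N : nat} (m : nat) (x : 'I_N -> F) : 'M[F]_(N, n) :=
  \matrix_(h, t) ((x h ^+ (m + n) + x h ^- (m + n)) * - (t == 0 :> nat)%:R).

(** The factor [(t.+1 == n)%:R] adds y^-m to the column y^m. *)
Definition merged_mx {n N : nat} (m : nat) (y : 'I_N -> F) : 'M[F]_(N, n + n) :=
  row_mx
    (\matrix_(h, t) (y h ^+ (m + (n - t.+1))
                     + (t.+1 == n)%:R * y h ^- (m + (n - t.+1))))
    (\matrix_(h, t) y h ^- (m + t.+1)).

(** Encodes y^b = (S_b + A_b)/2 and y^-b = (S_b - A_b)/2; each index equation matches the exponents
    of two columns. The entry 1 is for the column y^m + y^-m, which is S_m itself. *)
Definition recombination_mx (n : nat) : 'M[F]_(n + n) :=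
  block_mx
    (\matrix_(j, t) ((j == t)%:R * (if t.+1 == n then 1 else 2%:R^-1)))
    (\matrix_(j, t) ((j + t.+2 == n)%N%:R * 2%:R^-1))
    (\matrix_(j, t) ((j == t.+1 :> nat)%:R * 2%:R^-1))
    (\matrix_(j, t) ((j + t.+1 == n)%N%:R * - 2%:R^-1)).

Lemma sum_pick (n : nat) (g : 'I_n -> F) (P : pred 'I_n) (c : F) (i : 'I_n) :
  P =1 pred1 i -> \sum_j g j * ((P j)%:R * c) = g i * c.
Proof.
move=> Pi; rewrite (bigD1 i) //= Pi /= eqxx mul1r big1 ?addr0 // => j ji.
by rewrite Pi /= (negbTE ji) mul0r mulr0.
Qed.

Lemma sum_pick0 (n : nat) (g : 'I_n -> F) (P : pred 'I_n) (c : F) :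
  P =1 pred0 -> \sum_j g j * ((P j)%:R * c) = 0.
Proof. by move=> P0; rewrite big1 // => j _; rewrite P0 /= mul0r mulr0. Qed.

Lemma merged_mxE (n N m : nat) (y : 'I_N -> F) : 2%:R != 0 :> F ->
  merged_mx m y
  = row_mx (sym_mx m y) (sym_border m y + alt_mx m y) *m recombination_mx n.
Proof.
move=> two0; rewrite mul_row_block; congr row_mx; apply/matrixP=> h t.
- rewrite !mxE.
  under eq_bigr do rewrite !mxE.
  under [X in _ = _ + X]eq_bigr do rewrite !mxE.
  rewrite (@sum_pick _ _ _ _ t); last by move=> j.
  case: eqP => [tn|tn].
    rewrite sum_pick0 ?addr0 ?mulr1 ?mul1r // => j /=; have := ltn_ord j; lia.
  have t1 : (t.+1 < n)%N by have := ltn_ord t; lia.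
  rewrite (@sum_pick _ _ _ _ (Ordinal t1)) //= oppr0 mulr0 add0r mul0r addr0.
  by move: (y h ^+ _) (y h ^- _) => a b; field.
- rewrite !mxE.
  under eq_bigr do rewrite !mxE.
  under [X in _ = _ + X]eq_bigr do rewrite !mxE.
  have t1 : (n - t.+1 < n)%N by have := ltn_ord t; lia.
  rewrite [X in _ = _ + X](@sum_pick _ _ _ _ (Ordinal t1)); last first.
    by move=> j /=; rewrite -val_eqE /=; have := ltn_ord t; lia.
  have e1 : (n - (n - t.+1) = t.+1)%N by have := ltn_ord t; lia.
  rewrite /= e1.
  (* For y^-(m+n) no column of [sym_mx] has the right exponent; the border supplies -S_(m+n)
     instead. *)
  have [tn|tn] := eqVneq t.+1 n.
    rewrite sum_pick0 ?add0r; last by move=> j /=; lia.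
    by rewrite tn subnn eqxx mulr1n mulrN1; move: (y h ^+ _) (y h ^- _) => a b; field.
  have t2 : (n - t.+2 < n)%N by have := ltn_ord t; lia.
  rewrite (@sum_pick _ _ _ _ (Ordinal t2)); last first.
    by move=> j /=; rewrite -val_eqE /=; have := ltn_ord t; lia.
  have -> : (n - t.+1 == 0)%N = false by have := ltn_ord t; lia.
  have e2 : (n - (n - t.+2).+1 = t.+1)%N by have := ltn_ord t; lia.
  rewrite /= e2 oppr0 mulr0 add0r.
  by move: (y h ^+ _) (y h ^- _) => a b; field.
Qed.

Lemma schur_num_add (n m : nat) (y : 'I_(n + n) -> F) : (0 < n)%N ->
  (forall h, y h != 0) -> \prod_h y h = 1 ->
  schur_num (nseq n (2 * m)%N) y + schur_num (nseq n.-1 (2 * m)%N) y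
  = \det (merged_mx m y).
Proof.
move=> n0 y0 y1.
have n1 : (n.-1 < n + n)%N by lia.
have lift_neq t : (lift (Ordinal n1) t == n.-1 :> nat) = false.
  by apply/negbTE; rewrite eq_sym; exact: neq_lift (Ordinal n1) t.
pose E k := (\matrix_(h < n + n, t < n + n)
  y h ^+ (nth 0%N (nseq k (2 * m)%N) t + (n + n - t.+1))).
pose G := \matrix_(h < n + n, t < n + n)
   ((if t == n.-1 :> nat then y h ^+ (2 * m + n) + y h ^+ n
     else E n h t)).
(* [determinant_multilinear] acts on rows, whence the transposes. *)
rewrite /schur_num -det_tr -[X in _ + X]det_tr.
have -> : \det (E n)^T + \det (E n.-1)^T = \det G^T.
  rewrite -[\det (E n)^T]mul1r -[\det (E n.-1)^T]mul1r; apply/esym.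
  apply: (determinant_multilinear (i0 := Ordinal n1)).
  - apply/rowP=> h; rewrite !mxE /= eqxx !mul1r !nth_nseq ltnn.
    by have -> : (n.-1 < n)%N; [lia | congr (_ ^+ _ + _ ^+ _); lia].
  - by apply/matrixP=> t h; rewrite !mxE lift_neq.
  - apply/matrixP=> t h; rewrite !mxE lift_neq !nth_nseq.
    have := lift_neq t; set l := nat_of_ord _ => ln.
    by have -> : (l < n.-1 = (l < n))%N by lia.
rewrite det_tr.
have -> : G = diag_mx (\row_h y h ^+ (m + n)) *m merged_mx m y.
  apply/matrixP=> h t; rewrite mul_diag_mx !mxE.
  case: splitP => [u|u] tu; rewrite !mxE nth_nseq !tu.
  - have := ltn_ord u => un; rewrite un.
    have -> : (u == n.-1 :> nat) = (u.+1 == n) by lia.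
    case: eqP => [e|e].
      rewrite mul1r mulrDr -exprD; congr (_ + _); first by congr (_ ^+ _); lia.
      have -> : (m + (n - u.+1) = m)%N by lia.
      by rewrite [in RHS]exprD mulrAC divff ?mul1r ?expf_neq0.
    by rewrite mul0r addr0 -exprD; congr (_ ^+ _); lia.
  - have -> : (n + u == n.-1) = false by lia.
    have -> : (n + u < n)%N = false by lia.
    (* The exponent is (m+n) - (m+u+1); the negative power is cleared first. *)
    rewrite add0n; apply: (canRL (mulfK _)); first by rewrite expf_neq0.
    by rewrite -exprD; congr (_ ^+ _); have := ltn_ord u; lia.
rewrite det_mulmx det_diag.
under eq_bigr do rewrite mxE.
by rewrite prodrXl y1 expr1n mul1r.
Qed.

(** Inversion fixes S_b and negates A_b, so row h is row [idx h] of the matrices at [x], with a sign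
    on the A columns only. The border consists of S, hence falls in the upper block. *)
Lemma sym_alt_mxE (n N m : nat) (x : 'I_n -> F) (y : 'I_N -> F)
    (idx : 'I_N -> 'I_n) (inv : pred 'I_N) :
  (forall h, y h = if inv h then (x (idx h))^-1 else x (idx h)) ->
  row_mx (sym_mx m y) (sym_border m y + alt_mx m y)
  = row_mx (\matrix_(h, i) (i == idx h)%:R)
           (\matrix_(h, i) ((i == idx h)%:R * (-1) ^+ inv h))
    *m block_mx (sym_mx m x) (sym_border m x) 0 (alt_mx m x)
  :> 'M_(N, n + n).
Proof.
move=> yE; rewrite mul_row_block mulmx0 addr0.
have pick (A : 'M[F]_n) (c : 'I_N -> F) :
    (\matrix_(h, i) ((i == idx h)%:R * c h)) *m A
    = \matrix_(h, t) (c h * A (idx h) t).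
  apply/matrixP=> h t; rewrite !mxE.
  under eq_bigr do rewrite !mxE mulrC.
  by rewrite (@sum_pick _ _ _ _ (idx h)) // mulrC.
have pick1 (A : 'M[F]_n) :
    (\matrix_(h, i) (i == idx h)%:R) *m A = \matrix_(h, t) A (idx h) t.
  rewrite -[RHS](_ : \matrix_(h, t) (1 * A (idx h) t) = _); last first.
    by apply/matrixP=> h t; rewrite !mxE mul1r.
  by rewrite -pick; congr mulmx; apply/matrixP=> h t; rewrite !mxE mulr1.
rewrite !pick1 pick; congr row_mx; apply/matrixP=> h t; rewrite !mxE yE;
  case: (inv h); rewrite ?exprVn ?invrK ?expr0 ?expr1 ?mul1r ?mulN1r ?opprB //.
- by rewrite addrC.
- by rewrite [_^-1 + _ in LHS]addrC.
Qed.

(** The first and last determinants together form K: neither involves [m]. *)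
Lemma schur_num_factor (n m : nat) (x : 'I_n -> F) (y : 'I_(n + n) -> F)
    (idx : 'I_(n + n) -> 'I_n) (inv : pred 'I_(n + n)) :
  (0 < n)%N -> 2%:R != 0 :> F -> (forall h, y h != 0) -> \prod_h y h = 1 ->
  (forall h, y h = if inv h then (x (idx h))^-1 else x (idx h)) ->
  schur_num (nseq n (2 * m)%N) y + schur_num (nseq n.-1 (2 * m)%N) y
  = \det (row_mx (\matrix_(h, i) (i == idx h)%:R)
                 (\matrix_(h, i) ((i == idx h)%:R * (-1) ^+ inv h)))
    * (\det (sym_mx m x : 'M_n) * \det (alt_mx m x : 'M_n))
    * \det (recombination_mx n).
Proof.
move=> n0 two0 y0 y1 yE.
by rewrite schur_num_add // merged_mxE // (sym_alt_mxE _ _ _ _ _ _ _ yE) !det_mulmx det_ublock.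
Qed.

(** Reversing the columns gives a transposed Vandermonde matrix, whose determinant is a product of
    differences. *)
Lemma det_alternant_neq0 (N : nat) (y : 'I_N -> F) : injective y ->
  \det (\matrix_(h < N, t < N) y h ^+ (N - t.+1)) != 0.
Proof.
move=> y_inj.
have -> : \matrix_(h < N, t < N) y h ^+ (N - t.+1)
        = col_perm (perm rev_ord_inj) (Vandermonde N (\row_h y h))^T.
  by apply/matrixP=> h t; rewrite !mxE permE.
rewrite col_permE det_mulmx det_tr det_Vandermonde det_perm mulf_neq0 ?signr_eq0 //.
apply/prodf_neq0 => i _; apply/prodf_neq0 => j ij.
rewrite !mxE subr_eq0 (inj_eq y_inj).
by apply: contraTneq ij => ->; rewrite ltnn.
Qed.

(** The size [N] is a variable because [with_inv] has [n.*2] coordinates, while the block matrices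
    have size [n + n]. *)
Lemma schur_add_factor (n m N : nat) (x : 'I_n -> F) (y : 'I_N -> F)
    (idx : 'I_N -> 'I_n) (inv : pred 'I_N) :
  N = (n + n)%N ->
  (0 < n)%N -> 2%:R != 0 :> F -> (forall h, y h != 0) -> \prod_h y h = 1 ->
  (forall h, y h = if inv h then (x (idx h))^-1 else x (idx h)) ->
  injective y ->
  schur (nseq n (2 * m)%N) y + schur (nseq n.-1 (2 * m)%N) y
  = sp (nseq n m) x * o_even (nseq n m) x.
Proof.
move=> eN; subst N => n0 two0 y0 y1 yE y_inj.
have := schur_num_factor n m x y idx inv n0 two0 y0 y1 yE.
have := schur_num_factor n 0 x y idx inv n0 two0 y0 y1 yE.
have symE k : \matrix_(h < n, t < n)
    (x h ^+ (nth 0%N (nseq n k) t + (n - t.+1))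
     + x h ^- (nth 0%N (nseq n k) t + (n - t.+1))) = sym_mx k x.
  by apply/matrixP=> h t; rewrite !mxE nth_nseq ltn_ord.
have altE k : \matrix_(h < n, t < n)
    (x h ^+ (nth 0%N (nseq n k) t + (n - t))
     - x h ^- (nth 0%N (nseq n k) t + (n - t))) = alt_mx k x.
  by apply/matrixP=> h t; rewrite !mxE nth_nseq ltn_ord.
(* The denominators of [sp] and [o_even] are their numerators for m = 0. *)
rewrite /schur /sp /o_even symE altE -/(sym_mx 0 x) -/(alt_mx 0 x).
rewrite -/(schur_num (nseq n (2 * m)%N) y) -/(schur_num (nseq n.-1 (2 * m)%N) y).
have num0 k : schur_num (nseq k (2 * 0)%N) y
    = \det (\matrix_(h < n + n, t < n + n) y h ^+ (n + n - t.+1)).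
  congr determinant; apply/matrixP=> h t.
  by rewrite !mxE nth_nseq muln0 if_same.
have := det_alternant_neq0 _ y y_inj.
rewrite !num0 -mulrDl.
set D := \det _; set K := \det (row_mx _ _); set R := \det (recombination_mx _).
set S0 := \det (sym_mx 0 x); set A0 := \det (alt_mx 0 x).
move=> D0 eD ->.
(* The case m = 0 reads 2D = K S0 A0 R with D nonzero, so no factor vanishes; this 2 becomes the one
   in [o_even]. *)
have : K * (S0 * A0) * R != 0.
  by rewrite -eD -mulr2n -mulr_natr mulf_neq0.
rewrite !mulf_eq0 !negb_or => /andP[/andP[K0 /andP[S00 A00]] R0].
have -> : D = K * (S0 * A0) * R / 2%:R by rewrite -eD; field.
by field; rewrite ?K0 ?S00 ?A00 ?R0 ?two0.
Qed.

End Alternants.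

(** * Points closed under inversion *)

Lemma prod_with_inv (F : fieldType) (n : nat) (x : 'I_n -> F) :
  (forall i, x i != 0) -> \prod_h with_inv x h = 1.
Proof.
move=> x0.
(* Extending the coordinates to all naturals allows induction on the number of pairs; with default
   1, pairs out of range also have product 1. *)
pose g k := if insub k./2 is Some i then if odd k then (x i)^-1 else x i else 1.
have g_pair k : g k.*2 * g k.*2.+1 = 1.
  rewrite /g /= uphalf_double doubleK odd_double /=.
  by case: insubP => [i _ _|_]; rewrite ?mulr1 ?divff.
have -> : \prod_h with_inv x h = \prod_(h < n.*2) g h.
  apply: eq_bigr => h _; rewrite /with_inv /g.
  case: insubP => [i _ ih|/negP[]]; last by rewrite ltn_half_double.
  by rewrite (_ : Ordinal _ = i) //; apply: val_inj.
elim: (n) => [|k IH]; first by rewrite big_ord0.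
by rewrite doubleS !big_ord_recr /= IH mul1r g_pair.
Qed.

(** An index is determined by its parity and its half. Equal parities reduce to injectivity of [x];
    unequal ones would give x_i x_j = 1, possibly with i = j. *)
Lemma with_inv_inj (F : fieldType) (n : nat) (x : 'I_n -> F) :
  injective x -> (forall i j, x i * x j != 1) -> (forall i, x i != 0) ->
  injective (with_inv x).
Proof.
move=> x_inj xx x0 h k; rewrite /with_inv => e.
have xV i j : (x i)^-1 <> x j.
  by move=> ij; have := xx i j; rewrite -ij divff ?eqxx.
apply: val_inj; rewrite /= -(odd_double_half h) -(odd_double_half k).
move: e; case: (odd h); case: (odd k).
- by move/invr_inj/x_inj/(congr1 val) => /= ->.
- by move/xV.
- by move/esym/xV.
- by move/x_inj/(congr1 val) => /= ->.
Qed.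

(** * Genericity of the indeterminates, by evaluation of polynomials *)

Section Indeterminates.
Variable n : nat.

Lemma indet_inj : injective (indet n).
Proof.
move=> i j /eqP; rewrite /indet tofrac_eq => /eqP.
(* Evaluation at the i-th unit vector separates X_i from the other variables. *)
move/(congr1 (meval (fun k => (k == i)%:R))); rewrite !mevalXU eqxx.
by case: eqP => // _ /eqP; rewrite oner_eq0.
Qed.

Lemma indet_neq0 i : indet n i != 0.
Proof.
rewrite /indet tofrac_eq0; apply/eqP => /(congr1 (meval (fun=> 1))).
by rewrite mevalXU meval0 => /eqP; rewrite oner_eq0.
Qed.

Lemma indet_mul_neq1 i j : indet n i * indet n j != 1.
Proof.
rewrite /indet -tofracM -tofrac1 tofrac_eq; apply/eqP => /(congr1 (meval (fun=> 0))).
by rewrite mevalM !mevalXU meval1 mulr0 => /eqP; rewrite eq_sym oner_eq0.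
Qed.

Lemma two_neq0 : 2%:R != 0 :> {fraction {mpoly rat[n]}}.
Proof.
rewrite -[2%:R](rmorph_nat (@tofrac {mpoly rat[n]})) tofrac_eq0.
apply/eqP => /(congr1 (meval (fun=> 0))).
by rewrite rmorph_nat meval0.
Qed.

End Indeterminates.

Theorem theorem4 (m n : nat) (hn : (1 <= n)%N) :
  schur (nseq n (2 * m)%N) (with_inv (indet n))
  + schur (nseq n.-1 (2 * m)%N) (with_inv (indet n))
  = sp (nseq n m) (indet n) * o_even (nseq n m) (indet n).
Proof.
apply: (schur_add_factor _ _ _ _ _ _
  (fun h => Ordinal (etrans (ltn_half_double h n) (ltn_ord h))) (fun h => odd h)).
- by rewrite addnn.
- by [].
- exact: two_neq0.
- by move=> h; rewrite /with_inv; case: ifP => _; rewrite ?invr_eq0 indet_neq0.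
- exact/prod_with_inv/indet_neq0.
- by [].
- apply: with_inv_inj; [exact: indet_inj | exact: indet_mul_neq1 | exact: indet_neq0].
Qed.
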